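(* Let $F$ be a field of characteristic zero, $f$ an anti-involution of $F^\times$, and $\Phi_f(G)=(G,F^\times,\varphi,f)$ a skew gain graph whose underlying graph $G=K_{1,n}$ is a star of order $n+1$. Let $S=\sum_{e\in E(G)}g(\varphi(e))$. Then the eigenvalues of $A(\Phi_f(G))$ (in an algebraic closure of $F$, counted with algebraic multiplicity) are $-\sqrt{S}$ and $\sqrt{S}$, each with multiplicity $1$, and $0$ with multiplicity $n-1$.
   Context: An anti-involution of $F^\times$ is a map $f:F^\times\to F^\times$ with $f(f(x))=x$ and $f(xy)=f(y)f(x)$. A skew gain graph $(G,F^\times,\varphi,f)$ is a simple graph $G$ with vertices $v_1,\dots,v_m$ and a function $\varphi$ on oriented edges (both orientations of each edge) with values in $F^\times$ satisfying $\varphi(\overrightarrow{vu})=f(\varphi(\overrightarrow{uv}))$. Its adjacency matrix $A$ has $(i,j)$ entry $\varphi(\overrightarrow{v_iv_j})$ if $v_i\sim v_j$ and $0$ otherwise. $g(x)=xf(x)$, and for an edge $e=uv$, $g(\varphi(e))$ means $g(\varphi(\overrightarrow{uv}))$ (which equals $g(\varphi(\overrightarrow{vu}))$). $\sqrt{S}$ denotes a square root of $S$ in the algebraic closure of $F$. *)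

(* Defs.v *)
From HB Require Import structures.
From mathcomp Require Import all_boot all_order all_algebra.

Set Implicit Arguments.
Unset Strict Implicit.
Unset Printing Implicit Defensive.

Import GRing.Theory.
Local Open Scope ring_scope.

(* The multiplicative group F^*, as a subtype: the library's {unit F} is
   restricted to finite rings. *)
Definition Fstar (F : fieldType) : Type := {x : F | x != 0}.

Definition Fstar_mul (F : fieldType) (x y : Fstar F) : Fstar F :=
  exist _ (val x * val y) (mulf_neq0 (valP x) (valP y)).

Record antiInvolution (F : fieldType) := AntiInvolution {
  anti_fun :> Fstar F -> Fstar F;
  anti_funK : forall x, anti_fun (anti_fun x) = x;
  anti_funM : forall x y,
    anti_fun (Fstar_mul x y) = Fstar_mul (anti_fun y) (anti_fun x)
}.

Definition gain_norm (F : fieldType) (f : antiInvolution F) (x : Fstar F) :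
  Fstar F := Fstar_mul x (f x).

Record simpleGraph (m : nat) := SimpleGraph {
  adj :> rel 'I_m;
  adj_sym : symmetric adj;
  adj_irr : irreflexive adj
}.

Definition complete_bipartite (p q : nat) : rel ('I_p + 'I_q)%type :=
  fun x y => match x, y with
             | inl _, inr _ | inr _, inl _ => true
             | _, _ => false
             end.

(* G is a star K_{1,n} up to isomorphism: no vertex is singled out in advance
   as the centre. *)
Definition is_star (n : nat) (G : simpleGraph n.+1) : Prop :=
  exists2 h : 'I_n.+1 -> 'I_1 + 'I_n, bijective h &
    forall u v, G u v = complete_bipartite (h u) (h v).

(* The gain of the oriented edge (u, v) is [gain u v]; it is constrained, and
   used, only when u and v are adjacent. *)
Record skewGainGraph (F : fieldType) (f : antiInvolution F) (m : nat) :=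
  SkewGainGraph {
    sgg_graph :> simpleGraph m;
    gain : 'I_m -> 'I_m -> Fstar F;
    gain_rev : forall u v, sgg_graph u v -> gain v u = f (gain u v)
  }.

Section SkewGainGraph.

Variables (F : fieldType) (f : antiInvolution F) (m : nat).
Variable Phi : skewGainGraph f m.

Definition adjacency : 'M[F]_m :=
  \matrix_(i, j) if Phi i j then val (gain Phi i j) else 0.

Lemma gain_norm_rev (u v : 'I_m) :
  Phi u v -> gain_norm f (gain Phi v u) = gain_norm f (gain Phi u v).
Proof.
move=> uv; rewrite (gain_rev uv); apply: val_inj.
by rewrite /= anti_funK mulrC.
Qed.

(* Each edge uv is counted once, in the orientation u < v; by [gain_norm_rev]
   the orientation is immaterial. *)
Definition edge_norm_sum : F :=
  \sum_(u < m) \sum_(v < m | Phi u v && (u < v)%N)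
    val (gain_norm f (gain Phi u v)).

End SkewGainGraph.

Definition alg_multiplicity (K : fieldType) (m : nat) (B : 'M[K]_m) (a : K) :
  nat := mup a (char_poly B).

(* [s] lists the eigenvalues of B in K, repeated according to their algebraic
   multiplicity. *)
Definition eigenvalues_with_multiplicity (K : fieldType) (m : nat)
    (B : 'M[K]_m) (s : seq K) : Prop :=
  (forall a, eigenvalue B a = (a \in s)) /\
  (forall a, alg_multiplicity B a = count_mem a s).

Definition is_algebraic_closure (F : fieldType) (K : closedFieldType)
    (iota : {rmorphism F -> K}) : Prop :=
  integralRange iota.

(* Main.v *)
(** The adjacency matrix of a star with centre [c] is [A = e_c r + w e_c^T], with
    [r] and [w] its [c]-th row and column; thus [A = U V], where [U] has the two
    columns [e_c], [w] and [V] the two rows [r], [e_c^T]. By Sylvester's identity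
    [X^2 det(X - U V) = X^(n+1) det(X - V U)], where [V U] is the 2x2 matrix
    with rows [(0, r w)] and [(1, 0)], and [r w = S]. Hence the characteristic
    polynomial of [A] is [X^(n-1) (X^2 - S)]. *)
Require Import Defs.
From HB Require Import structures.
From mathcomp Require Import all_boot all_order all_algebra.

Import GRing.Theory.
Local Open Scope ring_scope.

(** Both sides equal ['X^p * \det M], where [M] has block rows [('X, U)] and [(V, 1)]: a
    block-triangular left factor of determinant [1] clears the block [U], and one of determinant
    ['X^p] clears the block [V]. *)
Lemma char_poly_mulmxC (R : comNzRingType) (m p : nat)
    (U : 'M[R]_(m, p)) (V : 'M[R]_(p, m)) :
  'X^p * char_poly (U *m V) = 'X^m * char_poly (V *m U).
Proof.
pose U' := map_mx polyC U; pose V' := map_mx polyC V.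
pose M := block_mx 'X%:M U' V' 1%:M.
have detM : \det M = char_poly (U *m V).
  have : \det (block_mx 1%:M (- U') 0 1%:M *m M) = char_poly (U *m V).
    rewrite mulmx_block !mul1mx !mul0mx !mulmx1 subrr !add0r det_lblock det1.
    by rewrite mulr1 mulNmx -map_mxM.
  by rewrite det_mulmx det_ublock !det1 !mul1r.
have : \det (block_mx 1%:M 0 (- V') 'X%:M *m M) = 'X^m * char_poly (V *m U).
  rewrite mulmx_block !mul1mx !mul0mx !mulmx1 !addr0 mul_mx_scalar.
  rewrite mul_scalar_mx scalerN addNr det_ublock det_scalar mulNmx -map_mxM.
  by rewrite addrC.
by rewrite det_mulmx det_lblock det1 mul1r det_scalar detM.
Qed.

Lemma det_block_mx11 (R : comNzRingType) (a b c d : 'M[R]_1) :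
  \det (block_mx a b c d) = a 0 0 * d 0 0 - b 0 0 * c 0 0.
Proof.
rewrite (expand_det_row _ (lshift 1 0)) big_split_ord !big_ord1.
rewrite block_mxEul block_mxEur /cofactor !det_mx11 !mxE.
have -> : @lift (1 + 1) (lshift 1 0) 0 = rshift 1 0 by apply: val_inj.
have -> : @lift (1 + 1) (rshift 1 0) 0 = lshift 1 0 by apply: val_inj.
rewrite !(unsplitK (inr _)) row_mxEl row_mxEr /=.
by rewrite expr0 expr1 mul1r mulN1r mulrN.
Qed.

Lemma char_poly_star (K : fieldType) (n : nat) (B : 'M[K]_n.+1) (c : 'I_n.+1) :
    (0 < n)%N -> (forall i j, (i == c) = (j == c) -> B i j = 0) ->
  char_poly B = ('X^2 - (\sum_j B c j * B j c)%:P) * 'X^(n - 1).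
Proof.
move=> n_gt0 B0.
pose U : 'M_(n.+1, 1 + 1) := row_mx (delta_mx c 0) (col c B).
pose V : 'M_(1 + 1, n.+1) := col_mx (row c B) (delta_mx 0 c).
have BE : B = U *m V.
  rewrite mul_row_col; apply/matrixP=> i j.
  rewrite !mxE !big_ord1 !mxE !eqxx /= andbT.
  have [->|ic] := eqVneq i c; have [->|jc] := eqVneq j c;
    rewrite /= ?mul1r ?mul0r ?mulr0 ?mulr1 ?addr0 ?add0r //.
    (* At [(c, c)] both summands of the product are [B c c], which is zero. *)
    by rewrite B0 ?addr0.
  by rewrite B0 // (negPf ic) (negPf jc).
have VUE : char_poly (V *m U) = 'X^2 - (\sum_j B c j * B j c)%:P.
  rewrite mul_col_row -rowE -colE -[delta_mx 0 c *m _]rowE.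
  (* Both diagonal blocks of [V *m U] reduce to the entry [B c c], hence vanish. *)
  have -> : col c (row c B) = 0 by apply/colP=> i; rewrite !mxE B0.
  have -> : row c (delta_mx c 0) = 1 :> 'M[K]_1.
    by apply/matrixP=> i j; rewrite !mxE !ord1 !eqxx.
  have -> : row c (col c B) = 0 by apply/colP=> i; rewrite !mxE B0.
  rewrite /char_poly /char_poly_mx map_block_mx scalar_mx_block.
  rewrite opp_block_mx add_block_mx det_block_mx11 !mxE !eqxx !mulr1n.
  rewrite !subr0 add0r sub0r mulrNN mulr1.
  by congr (_ - _%:P); apply: eq_bigr => j _; rewrite !mxE.
have X2neq0 : 'X^2 != 0 :> {poly K} by rewrite expf_neq0 ?polyX_eq0.
apply: (mulfI X2neq0).
have -> : 'X^2 * char_poly B = 'X^(n.+1) * char_poly (V *m U).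
  by rewrite -char_poly_mulmxC -BE.
(* Truncated subtraction: [2 + (n - 1) = n.+1] relies on [0 < n]. *)
by rewrite VUE mulrCA -exprD addnBA // add2n subn1 mulrC.
Qed.

Lemma eigenvalues_char_poly (K : fieldType) (m : nat) (B : 'M[K]_m)
    (s : seq K) :
  char_poly B = \prod_(a <- s) ('X - a%:P) -> eigenvalues_with_multiplicity B s.
Proof.
move=> BE; split=> a; first by rewrite eigenvalue_root_char BE root_prod_XsubC.
(* Multiplicities add over a product of nonzero polynomials, and the factor of [b] contributes [1]
   at [b] and [0] elsewhere. *)
rewrite /alg_multiplicity BE; elim: {BE}s => [|b s IHs].
  by rewrite big_nil mupNroot // rootC oner_eq0.
rewrite big_cons mupM ?polyXsubC_eq0 ?IHs //=; last first.
  by rewrite monic_neq0 ?monic_prod_XsubC.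
by rewrite -['X - b%:P]expr1 mup_XsubCX; case: eqP.
Qed.

(** The centre is the preimage of the only element of ['I_1]. The [!=] between booleans is an
    exclusive or: exactly one end of each edge is the centre. *)
Lemma star_centre (n : nat) (G : simpleGraph n.+1) :
  is_star G -> exists c, forall u v, G u v = ((u == c) != (v == c)).
Proof.
case=> h [h' hK h'K] GE; exists (h' (inl ord0)) => u v; rewrite GE.
have centreE w : (w == h' (inl ord0)) = if h w is inl _ then true else false.
  rewrite -(inj_eq (can_inj hK)) h'K.
  by case: (h w) => // i; rewrite ord1 eqxx.
by rewrite !centreE; case: (h u); case: (h v).
Qed.

(** Every edge joins [c] to some [v], and is counted from [c] if [c < v], from [v] otherwise. Since
    [gain_norm] ignores orientation, all edges can be read from [c]. *)
Lemma edge_norm_sum_star (F : fieldType) (f : antiInvolution F) (n : nat)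
    (Phi : skewGainGraph f n.+1) (c : 'I_n.+1) :
    (forall u v, Phi u v = ((u == c) != (v == c))) ->
  edge_norm_sum Phi = \sum_j adjacency Phi c j * adjacency Phi j c.
Proof.
move=> PhiE; rewrite /edge_norm_sum.
pose g v := val (gain_norm f (gain Phi c v)).
rewrite (bigD1 c) //=.
rewrite (eq_bigl (fun v : 'I__ => (v != c) && (c < v)%N)); last first.
  by move=> v; rewrite PhiE eqxx /=; case: (v == c).
(* For [u != c] the inner sum can only contain [v = c], and does so when [u < c], which is
   [~~ (c < u)] here. *)
rewrite [X in _ + X = _](eq_bigr (fun u : 'I__ =>
  if ~~ (c < u)%N then g u else 0)) /=; last first.
  move=> u uc; have Puc : Phi c u by rewrite PhiE eqxx (negPf uc).
  case: ltnP => cu.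
    rewrite big_pred0 // => v; rewrite PhiE (negPf uc) /=.
    by have [->|//] := eqVneq v c; rewrite ltnNge ltnW.
  rewrite (big_pred1 c) => [|v]; first exact: congr1 (gain_norm_rev Puc).
  rewrite PhiE (negPf uc) /=; have [->|//] := eqVneq v c.
  by rewrite ltn_neqAle cu andbT; apply: uc.
(* The two sums run over complementary sets of leaves and merge into one over [v != c]. *)
rewrite -big_mkcondr -bigID.
rewrite [RHS](bigD1 c) //= !mxE PhiE eqxx /= mul0r add0r.
apply: eq_bigr => v vc; have Pcv : Phi c v by rewrite PhiE eqxx (negPf vc).
by rewrite !mxE (adj_sym _ v) Pcv (gain_rev Pcv).
Qed.

Theorem theorem3p2 (F : fieldType) (F_char0 : [pchar F] =i pred0)
    (K : closedFieldType) (iota : {rmorphism F -> K})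
    (K_closure : is_algebraic_closure iota)
    (f : antiInvolution F) (n : nat) (n_gt0 : (0 < n)%N)
    (Phi : skewGainGraph f n.+1) (Phi_star : is_star Phi)
    (sqrtS : K) (sqrtSE : sqrtS ^+ 2 = iota (edge_norm_sum Phi)) :
  eigenvalues_with_multiplicity (map_mx iota (adjacency Phi))
    [:: - sqrtS, sqrtS & nseq (n - 1) 0].
Proof.
have [c PhiE] := star_centre _ _ Phi_star.
apply: eigenvalues_char_poly.
rewrite (char_poly_star _ _ _ c) //; last first.
  by move=> i j ij; rewrite !mxE PhiE ij eqxx rmorph0.
(* The zeros of the list give an iterated product of ['X], refolded into ['X^(n - 1)]; what remains
   is a difference of two squares. *)
rewrite !big_cons big_nseq subr0 -Monoid.iteropE -/(_ ^+ _) mulrA.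
congr (_ * _).
rewrite (eq_bigr (fun j => iota (adjacency Phi c j * adjacency Phi j c))).
  rewrite -rmorph_sum -(edge_norm_sum_star _ _ _ _ _ PhiE) -sqrtSE rmorphXn /=.
  by rewrite rmorphN opprK mulrC subr_sqr.
by move=> j _; rewrite !mxE rmorphM.
Qed.
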